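(* Let $\mathcal{H}$ be a complex Hilbert space and let $A,D\in\mathcal{B}(\mathcal{H})$. Then $$\|A+D\|^2\le\|A\|^2+\|D\|^2+\|A^*D+D^*A\|\le(\|A\|+\|D\|)^2.$$
   Context: $\mathcal{B}(\mathcal{H})$ is the set of bounded linear operators on $\mathcal{H}$, $A^*$ is the adjoint of $A$, and $\|\cdot\|$ is the operator norm. *)

(* Defs.v *)
From HB Require Import structures.
From mathcomp Require Import all_boot all_order all_algebra.
From mathcomp Require Import complex.
From mathcomp Require Import all_classical all_reals all_analysis.

Set Implicit Arguments.
Unset Strict Implicit.
Unset Printing Implicit Defensive.

Import Order.TTheory GRing.Theory Num.Theory.
Import numFieldNormedType.Exports.

Local Open Scope classical_set_scope.
Local Open Scope ring_scope.
Local Open Scope complex_scope.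

(* A complex Hilbert space over the scalars R[i]: a Banach space whose norm is
   induced by an inner product. The inner product is linear in its first
   argument and conjugate-linear in the second. *)
HB.mixin Record NormedModule_hasInner (R : realType) H
    of NormedModule R[i] H := {
  inner : {dot H for (@Num.conj R[i])} ;
  sqr_norm_inner : forall x : H, `|x| ^+ 2 = inner x x
}.

#[short(type="hilbertType")]
HB.structure Definition Hilbert (R : realType) :=
  {H of CompleteNormedModule R[i] H & NormedModule_hasInner R H}.

Definition bounded_operators (R : realType) (H : hilbertType R) :
    set (H -> H) :=
  [set A | linear A /\ exists M : R, forall x, `|A x| <= M%:C * `|x|].

(* `|A x| is a nonnegative element of R[i]; complex.Re returns it as an element
   of R, where suprema are available. The set is nonempty (x = 0), and bounded
   above when A is a bounded operator. *)
Definition opnorm (R : realType) (H : hilbertType R) (A : H -> H) : R :=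
  sup [set complex.Re `|A x| | x in [set x : H | `|x| <= 1]].

(* The adjoint of a bounded operator exists by the Riesz representation theorem
   and is unique; the default value of xget is never reached for bounded A. *)
Definition adjoint (R : realType) (H : hilbertType R) (A : H -> H) : H -> H :=
  xget (fun=> 0) [set B | bounded_operators B /\
                          forall x y : H, inner (A x) y = inner x (B y)].

(* Main.v *)
(** For every x, |(A + D) x|^2 = |A x|^2 + |D x|^2 + Re <(A^* D + D^* A) x, x>,
    and Cauchy-Schwarz bounds the last term by |A^* D + D^* A| |x|^2; this is
    the first inequality.  The second one follows from |A^*| <= |A| and
    submultiplicativity.  These facts need the existence of adjoints, i.e. the
    Riesz representation theorem.  A bounded real-linear functional f is
    represented by the minimizer of J x = |x|^2 - 2 f x: near-minimizers form a
    Cauchy filter by the parallelogram law, and at a near-minimizer x the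
    derivative of J, y |-> 2 (Re <x, y> - f y), is small. *)

Require Import Defs.
From HB Require Import structures.
From mathcomp Require Import all_boot all_order all_algebra.
From mathcomp Require Import complex.
From mathcomp Require Import all_classical all_reals all_analysis.
From mathcomp Require Import ring lra.

Set Implicit Arguments.
Unset Strict Implicit.

Import Order.TTheory GRing.Theory Num.Theory.
Import numFieldNormedType.Exports.
Local Open Scope classical_set_scope.
Local Open Scope ring_scope.

Lemma Re_realM (R : realType) (c : R) (w : R[i]) :
  complex.Re (c%:C%C * w) = c * complex.Re w.
Proof. by case: w => a b; rewrite -[LHS]/(c * a - 0 * b) mul0r subr0. Qed.

Lemma linear_scale (K : pzRingType) (U V : lmodType K) (A : U -> V) c x :
  linear A -> A (c *: x) = c *: A x.
Proof.
move=> lA; have A0 : A 0 = 0.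
  by have := lA (-1) 0 0; rewrite scaler0 addr0 scaleN1r addNr.
by rewrite -[c *: x]addr0 lA A0 addr0.
Qed.

Lemma linear_add (K : pzRingType) (U V : lmodType K) (A : U -> V) x y :
  linear A -> A (x + y) = A x + A y.
Proof. by move=> lA; have := lA 1 x y; rewrite !scale1r. Qed.

(** * The real inner product space underlying [H] *)

Section RealParts.
Variables (R : realType) (H : hilbertType R).
Implicit Types (x y z : H) (c : R).

(** Norms take values in [R[i]], whose order is only partial. Passing to real parts gives
    inequalities over [R], within reach of [lra] and [nra]. *)
Definition rnorm x : R := complex.Re `|x|.
Definition rinner x y : R := complex.Re (inner x y).

Lemma rnormE x : `|x| = (rnorm x)%:C%C.
Proof. by rewrite /rnorm RRe_real// normr_real. Qed.

Lemma rnorm_ge0 x : 0 <= rnorm x.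
Proof. by rewrite -lecR -rnormE; exact: normr_ge0. Qed.

Lemma rnormD x y : rnorm (x + y) <= rnorm x + rnorm y.
Proof. by rewrite -lecR rmorphD/= -!rnormE ler_normD. Qed.

Lemma rnormZ c x : rnorm (c%:C%C *: x) = `|c| * rnorm x.
Proof.
apply: complexI; rewrite rmorphM/= -!rnormE normrZ normc_def /=.
by rewrite expr0n addr0 sqrtr_sqr.
Qed.

Lemma rinnerxx x : rinner x x = rnorm x ^+ 2.
Proof. by rewrite /rinner -sqr_norm_inner rnormE -rmorphXn. Qed.

Lemma rinnerC x y : rinner x y = rinner y x.
Proof. by rewrite /rinner hermC /= expr0 mul1r; case: (inner y x). Qed.

Lemma rinnerDl x y z : rinner (x + y) z = rinner x z + rinner y z.
Proof. by rewrite /rinner linearDl raddfD. Qed.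

Lemma rinnerDr x y z : rinner x (y + z) = rinner x y + rinner x z.
Proof. by rewrite rinnerC rinnerDl !(rinnerC x). Qed.

Lemma rinnerZl c x y : rinner (c%:C%C *: x) y = c * rinner x y.
Proof. by rewrite /rinner linearZl_LR Re_realM. Qed.

Lemma rinnerZr c x y : rinner x (c%:C%C *: y) = c * rinner x y.
Proof. by rewrite rinnerC rinnerZl rinnerC. Qed.

Lemma rnormD_sqr x y :
  rnorm (x + y) ^+ 2 = rnorm x ^+ 2 + rnorm y ^+ 2 + 2 * rinner x y.
Proof. by rewrite -!rinnerxx rinnerDl !rinnerDr (rinnerC y x); ring. Qed.

(* Cauchy-Schwarz is read off the triangle inequality of the given norm. *)
Lemma rinner_le x y : rinner x y <= rnorm x * rnorm y.
Proof.
have := rnormD x y; rewrite -ler_sqr ?nnegrE ?addr_ge0 ?rnorm_ge0//.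
rewrite rnormD_sqr; nra.
Qed.

Lemma norm_rinner_le x y : `|rinner x y| <= rnorm x * rnorm y.
Proof.
rewrite ler_norml rinner_le andbT lerNl.
have <- : rnorm ((-1)%:C%C *: x) = rnorm x by rewrite rnormZ normrN1 mul1r.
by rewrite -[- rinner x y]mulN1r -rinnerZl rinner_le.
Qed.

(** * Riesz representation of bounded real-linear functionals *)

Section Riesz.
Variables (f : H -> R) (M : R).
Hypothesis fD : {morph f : x y / x + y}.
Hypothesis fZ : forall c x, f (c%:C%C *: x) = c * f x.
Hypothesis fM : forall x, f x <= M * rnorm x.

Let J x := rnorm x ^+ 2 - 2 * f x.

(** Along a real line [J] is a quadratic polynomial in [c]; its linear coefficient is the derivative
    of [J] at [x] in direction [y]. *)
Let JD x y c : J (x + c%:C%C *: y) =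
  J x + 2 * c * (rinner x y - f y) + c ^+ 2 * rnorm y ^+ 2.
Proof.
rewrite /J rnormD_sqr fD fZ rnormZ rinnerZr exprMn real_normK ?num_real//.
ring.
Qed.

Let m := inf (range J).

Let has_inf_J : has_inf (range J).
Proof.
split; first by exists (J 0), 0.
(* Completing the square, [J x >= (rnorm x - M)^2 - M^2]. *)
exists (- M ^+ 2) => _ [x _ <-]; rewrite /J.
have := fM x; have := sqr_ge0 (rnorm x - M); nra.
Qed.

Let m_le x : m <= J x.
Proof. by apply: ge_inf; [exact: has_inf_J.2|exists x]. Qed.

(** Neither step [s] nor step [-s] along [y] brings [J] below [m], so twice [s] times the left-hand
    side is at most [s^2 * (rnorm y ^+ 2 + 1)]. *)
Let near_min_gradient x y s : 0 < s -> J x < m + s ^+ 2 ->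
  `|rinner x y - f y| <= s * (rnorm y ^+ 2 + 1) / 2.
Proof.
move=> s0 Jx; have := m_le (x + s%:C%C *: y).
have := m_le (x + (- s)%:C%C *: y).
rewrite !JD sqrrN => h1 h2.
rewrite -(ler_pM2l s0) -{1}(gtr0_norm s0) -normrM ler_norml.
by apply/andP; split; nra.
Qed.

(** Parallelogram law: [J x + J y] minus twice [J] at the midpoint is [rnorm (y - x) ^+ 2 / 2], and
    [J >= m] at the midpoint makes this less than [2 * s^2]. *)
Let near_min_close x y s : 0 < s -> J x < m + s ^+ 2 -> J y < m + s ^+ 2 ->
  rnorm (y - x) < 2 * s.
Proof.
move=> s0 Jx.
have -> : J y = J (x + 1%:C%C *: (y - x)).
  by rewrite scale1r addrC subrK.
have := m_le (x + (2^-1)%:C%C *: (y - x)).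
rewrite !JD => h1 h2.
rewrite -ltr_sqr ?nnegrE ?rnorm_ge0 ?mulr_ge0 ?ltW//.
lra.
Qed.

Let F := filter_from [set s : R | 0 < s] (fun s => [set x | J x < m + s ^+ 2]).

Let F_proper : ProperFilter F.
Proof.
apply: filter_from_proper => [|s /= s0]; last first.
  have [_ [x _ <-] Jx] := inf_adherent (exprn_gt0 2 s0) has_inf_J.
  by exists x.
apply: filter_from_filter; first by exists 1; exact: ltr01.
move=> s t /= s0 t0; have st0 : 0 < Num.min s t by rewrite lt_min s0.
exists (Num.min s t) => //= x Jx.
by split; apply: (lt_le_trans Jx); rewrite lerD2l ler_pXn2r ?nnegrE
  ?(ltW s0, ltW t0, ltW st0)// ge_min lexx ?orbT.
Qed.

Lemma riesz_real : exists v, forall y, f y = rinner y v.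
Proof.
have PF := F_proper; have FF : Filter F := @filter_filter _ _ PF.
have F_cvg : cvg F.
  apply: cauchy_cvg; apply: cauchy_exP => e.
  (* A positive element of [R[i]] has zero imaginary part, so the radius is a real [e]. *)
  case: e => e e'; rewrite ltcE /= => /andP[/eqP -> e0].
  (* Near-minimizers at level [s] are within [2 * s] of each other, hence the choice [s = e / 2]. *)
  have s0 : 0 < e / 2 by rewrite divr_gt0.
  have [_ [x _ <-] Jx] := inf_adherent (exprn_gt0 2 s0) has_inf_J.
  exists x, (e / 2) => // y Jy.
  rewrite -ball_normE /= distrC rnormE -[Complex e 0]/(e%:C%C) ltcR.
  have := near_min_close s0 Jx Jy; lra.
exists (lim F) => y; apply/eqP; rewrite -subr_eq0 -normr_eq0.
set b := `|_|; apply/negPn/negP => b0.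
have {}b0 : 0 < b by rewrite lt_def b0 normr_ge0.
(* The first summand comes from the derivative at a near-minimizer [x], the second from replacing
   [x] by the limit, at distance less than [s]. *)
set K := (rnorm y ^+ 2 + 1) / 2 + rnorm y.
have K0 : 0 < K.
  by have := rnorm_ge0 y; have := sqr_ge0 (rnorm y); rewrite /K; lra.
have bK s : 0 < s -> b <= s * K.
  move=> s0.
  have Fs : F [set x | J x < m + s ^+ 2] by exists s.
  have s0' : 0 < s%:C%C by rewrite ltcR.
  have /(@filter_ex _ _ PF) [x [/= Jx]] :=
    @filterI _ _ FF _ _ Fs (F_cvg _ (nbhsx_ballx (lim F) _ s0')).
  rewrite -ball_normE /= rnormE ltcR => vx.
  rewrite /b distrC.
  have -> : rinner y (lim F) - f y = (rinner x y - f y) + rinner y (lim F - x).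
    by rewrite (rinnerC x) -[in LHS](subrK x (lim F)) rinnerDr; ring.
  apply: (le_trans (ler_normD _ _)).
  rewrite /K mulrDr mulrA lerD ?near_min_gradient//.
  apply: (le_trans (norm_rinner_le _ _)).
  by rewrite mulrC ler_wpM2r ?rnorm_ge0 ?ltW.
(* This [s] yields [b <= b / 2], contradicting [0 < b]. *)
have := bK (b / K / 2); rewrite !divr_gt0// => /(_ isT).
rewrite mulrAC divfK ?gt_eqF//; lra.
Qed.

End Riesz.

(** [c = 1] compares the real parts and [c = 'i] the imaginary parts, since
    [Re ('i * w) = - Im w]. *)
Lemma inner_eq_rinner x y z t :
  (forall c : R[i], rinner (c *: x) y = rinner (c *: z) t) ->
  inner x y = inner z t.
Proof.
move=> h; apply/eqP; rewrite eq_complex.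
have := h 1; rewrite !scale1r /rinner => ->; rewrite eqxx /=.
have := h 'i%C; rewrite /rinner !linearZl_LR /= ![_ * inner _ _]mulrC !ReiNIm.
by move=> /oppr_inj ->.
Qed.

(** * Adjoints of bounded operators *)

Section Operators.
Implicit Types A B : H -> H.

Lemma bounded_operatorsP A : bounded_operators A ->
  exists2 M, 0 <= M & forall x, rnorm (A x) <= M * rnorm x.
Proof.
(* The given [M] may be negative when [H] is trivial. *)
move=> [_ [M hM]]; exists `|M| => // x.
apply: (@le_trans _ _ (M * rnorm x)).
  by rewrite -lecR rmorphM /= -!rnormE.
by rewrite ler_wpM2r ?rnorm_ge0 ?ler_norm.
Qed.

Lemma rinner_inj u v : (forall x, rinner x u = rinner x v) -> u = v.
Proof.
move=> h; apply/eqP; rewrite -subr_eq0 -normr_eq0 rnormE.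
have : rnorm (u - v) ^+ 2 = 0.
  rewrite -rinnerxx -scaleN1r -[-1](rmorphN1 (real_complex R)).
  by rewrite rinnerDr rinnerZr h; ring.
by move/eqP; rewrite sqrf_eq0 => /eqP ->.
Qed.

Lemma adjoint_exists A : bounded_operators A -> exists B, bounded_operators B /\
  forall x y, inner (A x) y = inner x (B y).
Proof.
move=> bA; have [lA _] := bA; have [M M0 hM] := bounded_operatorsP bA.
(* For fixed [z] the functional is real-linear with bound [M * rnorm z]. The complex identity [BE]
   follows because [A] commutes with complex scalars. *)
have riesz z : exists v, forall x, rinner (A x) z = rinner x v.
  apply: (@riesz_real _ (M * rnorm z)) => [x y|c x|x].
  - by rewrite linear_add// rinnerDl.
  - by rewrite linear_scale// rinnerZl.
  - apply: (le_trans (rinner_le _ _)).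
    by rewrite mulrAC ler_wpM2r ?rnorm_ge0.
pose B z := projT1 (cid (riesz z)).
have BP x z : rinner (A x) z = rinner x (B z).
  exact: (projT2 (cid (riesz z))).
have BE x z : inner (A x) z = inner x (B z).
  by apply: inner_eq_rinner => c; rewrite -linear_scale// BP.
exists B; split=> //; split.
  move=> c y z; apply: rinner_inj => x.
  rewrite -BP /rinner linearDr linearZr_LR /= !BE.
  by rewrite linearDr linearZr_LR.
exists M => x; rewrite !rnormE -rmorphM lecR.
have [->|Bx0] := eqVneq (rnorm (B x)) 0; first by rewrite mulr_ge0 ?rnorm_ge0.
have {}Bx0 : 0 < rnorm (B x) by rewrite lt_def Bx0 rnorm_ge0.
(* The square of [rnorm (B x)] is [rinner (A (B x)) x]; Cauchy-Schwarz and one cancelled factor give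
   the bound. *)
rewrite -(ler_pM2r Bx0) -expr2 -rinnerxx -BP.
apply: (le_trans (rinner_le _ _)).
by rewrite mulrAC ler_wpM2r ?rnorm_ge0.
Qed.

Lemma adjointP A : bounded_operators A -> bounded_operators (adjoint A) /\
  forall x y, inner (A x) y = inner x (adjoint A y).
Proof. by move=> /adjoint_exists; exact: xgetPex. Qed.

Lemma rinner_adjoint A x y : bounded_operators A ->
  rinner (A x) y = rinner x (adjoint A y).
Proof. by move=> /adjointP[_ adjA]; rewrite /rinner adjA. Qed.

(** * The operator norm *)

Lemma has_sup_opnorm A : bounded_operators A ->
  has_sup [set complex.Re `|A x| | x in [set x : H | `|x| <= 1]].
Proof.
move=> bA; have [M M0 hM] := bounded_operatorsP bA; split.
  by exists (rnorm (A 0)), 0 => //=; rewrite normr0.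
exists M => _ [x /= x1 <-]; apply: (le_trans (hM x)).
by rewrite ler_piMr// -lecR -rnormE.
Qed.

Lemma opnorm_ge0 A : bounded_operators A -> 0 <= opnorm A.
Proof.
move=> /has_sup_opnorm bA; apply: (@le_trans _ _ (rnorm (A 0))).
  exact: rnorm_ge0.
by apply: (ub_le_sup bA.2); exists 0 => //=; rewrite normr0.
Qed.

Lemma rnorm_le_opnorm A x : bounded_operators A ->
  rnorm (A x) <= opnorm A * rnorm x.
Proof.
move=> bA; have [M M0 hM] := bounded_operatorsP bA.
have [x0|x0] := eqVneq (rnorm x) 0.
  by rewrite x0 mulr0 (le_trans (hM x))// x0 mulr0.
have {}x0 : 0 < rnorm x by rewrite lt_def x0 rnorm_ge0.
(* Rescale [x] to a unit vector, where the supremum applies directly. *)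
rewrite -ler_pdivrMr// mulrC -(gtr0_norm (x := (rnorm x)^-1)) ?invr_gt0//.
rewrite -rnormZ -(linear_scale _ _ bA.1).
apply: (ub_le_sup (has_sup_opnorm bA).2).
exists (((rnorm x)^-1)%:C%C *: x) => //.
by rewrite /= rnormE lecR rnormZ gtr0_norm ?invr_gt0// mulVf ?gt_eqF.
Qed.

Lemma opnorm_le A c : 0 <= c -> (forall x, rnorm (A x) <= c * rnorm x) ->
  opnorm A <= c.
Proof.
move=> c0 Ac; apply: ge_sup.
  by exists (rnorm (A 0)), 0 => //=; rewrite normr0.
move=> _ [x /= x1 <-]; apply: (le_trans (Ac x)).
by rewrite ler_piMr// -lecR -rnormE.
Qed.

Lemma bounded_comp A B : bounded_operators A -> bounded_operators B ->
  bounded_operators (A \o B).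
Proof.
move=> bA bB; split=> [c x y /=|]; first by rewrite bB.1 bA.1.
exists (opnorm A * opnorm B) => x.
rewrite !rnormE -rmorphM lecR -mulrA (le_trans (rnorm_le_opnorm _ bA))//.
by rewrite ler_wpM2l ?opnorm_ge0 ?rnorm_le_opnorm.
Qed.

Lemma bounded_add A B : bounded_operators A -> bounded_operators B ->
  bounded_operators (A \+ B).
Proof.
move=> bA bB; split=> [c x y /=|].
  by rewrite bB.1 bA.1 scalerDr addrACA.
exists (opnorm A + opnorm B) => x.
rewrite !rnormE -rmorphM lecR (le_trans (rnormD _ _))// mulrDl.
by rewrite lerD ?rnorm_le_opnorm.
Qed.

Lemma opnorm_adjoint_le A : bounded_operators A ->
  opnorm (adjoint A) <= opnorm A.
Proof.
move=> bA; apply: opnorm_le => [|x]; first exact: opnorm_ge0.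
have [->|Ax0] := eqVneq (rnorm (adjoint A x)) 0.
  by rewrite mulr_ge0 ?rnorm_ge0 ?opnorm_ge0.
have {}Ax0 : 0 < rnorm (adjoint A x) by rewrite lt_def Ax0 rnorm_ge0.
rewrite -(ler_pM2r Ax0) -expr2 -rinnerxx -rinner_adjoint//.
by rewrite (le_trans (rinner_le _ _))// mulrAC ler_wpM2r ?rnorm_ge0
  ?rnorm_le_opnorm.
Qed.

Lemma opnorm_comp_le A B : bounded_operators A -> bounded_operators B ->
  opnorm (A \o B) <= opnorm A * opnorm B.
Proof.
move=> bA bB; apply: opnorm_le => [|x]; first by rewrite mulr_ge0 ?opnorm_ge0.
rewrite -mulrA (le_trans (rnorm_le_opnorm _ bA))//.
by rewrite ler_wpM2l ?opnorm_ge0 ?rnorm_le_opnorm.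
Qed.

Lemma opnorm_add_le A B : bounded_operators A -> bounded_operators B ->
  opnorm (A \+ B) <= opnorm A + opnorm B.
Proof.
move=> bA bB; apply: opnorm_le => [|x]; first by rewrite addr_ge0 ?opnorm_ge0.
by rewrite (le_trans (rnormD _ _))// mulrDl lerD ?rnorm_le_opnorm.
Qed.

End Operators.
End RealParts.

Theorem theorem2p4 (R : realType) (H : hilbertType R) (A D : H -> H)
    (hA : bounded_operators A) (hD : bounded_operators D) :
  opnorm (A \+ D) ^+ 2
    <= opnorm A ^+ 2 + opnorm D ^+ 2
       + opnorm ((adjoint A \o D) \+ (adjoint D \o A))
    <= (opnorm A + opnorm D) ^+ 2.
Proof.
have [hA' _] := adjointP hA; have [hD' _] := adjointP hD.
have hAD := bounded_comp hA' hD; have hDA := bounded_comp hD' hA.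
have hT := bounded_add hAD hDA.
apply/andP; split; last first.
  (* After expanding the square, each of the two products has to be bounded by
     [opnorm A * opnorm D]. *)
  rewrite sqrrD [leRHS]addrAC lerD2l (le_trans (opnorm_add_le hAD hDA))//.
  rewrite mulr2n lerD//.
    by rewrite (le_trans (opnorm_comp_le hA' hD))// ler_wpM2r ?opnorm_ge0
      ?opnorm_adjoint_le.
  rewrite mulrC (le_trans (opnorm_comp_le hD' hA))// ler_wpM2r ?opnorm_ge0//.
  exact: opnorm_adjoint_le.
set T := _ \+ _ in hT *; set K := _ + _ + _.
have K0 : 0 <= K by rewrite !addr_ge0 ?sqr_ge0 ?opnorm_ge0.
(* With [K] written as a square, it suffices that [Num.sqrt K] bounds [A \+ D] pointwise. *)
rewrite -(sqr_sqrtr K0) ler_sqr ?nnegrE ?sqrtr_ge0 ?opnorm_ge0//; last first.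
  exact: bounded_add.
apply: opnorm_le => [|x]; first exact: sqrtr_ge0.
rewrite -ler_sqr ?nnegrE ?mulr_ge0 ?sqrtr_ge0 ?rnorm_ge0//.
have sqr_le B : bounded_operators B ->
    rnorm (B x) ^+ 2 <= opnorm B ^+ 2 * rnorm x ^+ 2.
  by move=> bB; rewrite -exprMn ler_sqr ?nnegrE ?mulr_ge0 ?opnorm_ge0
    ?rnorm_ge0 ?rnorm_le_opnorm.
rewrite exprMn sqr_sqrtr//= rnormD_sqr /K [leRHS]mulrDl.
rewrite [X in _ <= X + _]mulrDl !lerD ?sqr_le//.
(* Moving the adjoints across turns the cross term into the quadratic form of [T]. *)
have -> : 2 * rinner (A x) (D x) = rinner x (T x).
  by rewrite rinnerDr /= -!rinner_adjoint// (rinnerC (D x)) mulr_natl mulr2n.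
rewrite (le_trans (rinner_le _ _))// expr2 mulrA mulrC.
by rewrite ler_wpM2r ?rnorm_ge0 ?rnorm_le_opnorm.
Qed.
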